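(* Let $\mathbb{K}$ be a field, let $k\geq 3$, and let $X\subset\mathbb{P}^{k-1}$ be a finite set of $n$ distinct $\mathbb{K}$-rational points, not all contained in a hyperplane. Let $a$ be an integer with $1\leq a\leq \alpha(X)-1$. Then $$d(X)_a\geq \binom{\alpha(X)-1-a+k-1}{k-1}.$$
   Context: $R=\mathbb{K}[x_1,\ldots,x_k]$ is the polynomial ring with the standard grading and $R_a$ is the $\mathbb{K}$-vector space of homogeneous polynomials of degree $a$. For a finite set of $\mathbb{K}$-rational points $X=\{P_1,\ldots,P_n\}\subset\mathbb{P}^{k-1}$, $I(X)\subset R$ is its (homogeneous) defining ideal, i.e. the ideal generated by all forms vanishing at every point of $X$. The initial degree $\alpha(X)$ is the smallest degree of a nonzero element of $I(X)$. Fix for each $P_i$ the representative in $\mathbb{K}^k$ whose leftmost nonzero coordinate is $1$. The evaluation code of order $a$ associated to $X$ is the image $\mathcal{C}(X)_a\subset\mathbb{K}^n$ of the linear map $R_a\to\mathbb{K}^n$, $f\mapsto (f(P_1),\ldots,f(P_n))$. Its minimum (Hamming) distance is denoted $d(X)_a$. Equivalently, $d(X)_a$ is the minimum, over all $f\in R_a\setminus I(X)$, of the number of points of $X$ at which $f$ does not vanish. *)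

(* Defs.v *)
From HB Require Import structures.
From mathcomp Require Import all_boot all_order all_algebra.
From mathcomp Require Export mpoly.
From Stdlib Require Import ClassicalEpsilon.

Set Implicit Arguments.
Unset Strict Implicit.
Unset Printing Implicit Defensive.

Import GRing.Theory.
Local Open Scope ring_scope.

(* Minima of sets of natural numbers with no decidable membership; the value is
   unspecified on the empty set. *)
Definition is_least (P : nat -> Prop) (m : nat) : Prop :=
  P m /\ (forall j, P j -> (m <= j)%N).

Definition least (P : nat -> Prop) : nat := epsilon (inhabits 0%N) (is_least P).

Lemma leastP (P : nat -> Prop) : (exists m, P m) -> is_least P (least P).
Proof.
move=> [m Pm]; apply: epsilon_spec.
pose b j : bool := if excluded_middle_informative (P j) then true else false.
have bP j : reflect (P j) (b j).
  by rewrite /b; case: excluded_middle_informative => h; constructor.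
have exb : exists j, b j by exists m; apply/bP.
by case: (ex_minnP exb) => j /bP Pj minj; exists j; split=> // i /bP /minj.
Qed.

Section EvaluationCodes.

Variables (K : fieldType) (k : nat).

(* A K-rational point of P^(k-1) is identified with its unique representative
   whose leftmost nonzero coordinate is 1. *)
Definition normalized (v : 'rV[K]_k) : bool :=
  [exists i : 'I_k, (v 0 i == 1) && [forall j : 'I_k, (j < i)%N ==> (v 0 j == 0)]].

Record ppoint := PPoint { prep :> 'rV[K]_k; _ : normalized prep }.

HB.instance Definition _ := [isSub for prep].
HB.instance Definition _ := [Choice of ppoint by <:].

Definition peval (f : {mpoly K[k]}) (P : ppoint) : K := f.@[fun i => P 0 i].

Definition on_hyperplane (h : 'rV[K]_k) (P : ppoint) : bool :=
  \sum_(i < k) h 0 i * P 0 i == 0.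

Definition in_hyperplane (X : seq ppoint) : Prop :=
  exists2 h : 'rV[K]_k, h != 0 & all (on_hyperplane h) X.

Definition generated_ideal (G : {mpoly K[k]} -> Prop) (f : {mpoly K[k]}) : Prop :=
  exists s : seq ({mpoly K[k]} * {mpoly K[k]}),
    (forall p, p \in s -> G p.2) /\ f = \sum_(p <- s) p.1 * p.2.

Definition vanishing_form (X : seq ppoint) (f : {mpoly K[k]}) : Prop :=
  (exists d : nat, f \is d.-homog) /\ (forall P, P \in X -> peval f P = 0).

Definition defining_ideal (X : seq ppoint) : {mpoly K[k]} -> Prop :=
  generated_ideal (vanishing_form X).

(* [msize f] is the total degree of [f] plus one when [f] is nonzero. *)
Definition initial_degree (X : seq ppoint) : nat :=
  least (fun d => exists f,
    [/\ defining_ideal X f, f != 0 & d = (msize f).-1]).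

Definition evaluation_code n (X : n.-tuple ppoint) (d : nat) (c : 'rV[K]_n) : Prop :=
  exists2 f : {mpoly K[k]},
    f \is d.-homog & c = \row_(i < n) peval f (tnth X i).

End EvaluationCodes.

Definition hamming_distance (K : fieldType) n (u v : 'rV[K]_n) : nat :=
  #|[set i : 'I_n | u 0 i != v 0 i]|.

Definition minimum_distance (K : fieldType) n (C : 'rV[K]_n -> Prop) : nat :=
  least (fun d => exists u v,
    [/\ C u, C v, u != v & d = hamming_distance u v]).

(* Main.v *)
(** If [f] is a form of degree [a] that is nonzero at fewer points of [X] than
    there are monomials of degree [b = alpha(X) - 1 - a], then by counting
    dimensions some nonzero form [g] of degree [b] vanishes at all those points.
    The product [f * g] is then a nonzero form of degree [alpha(X) - 1]
    vanishing on [X], which contradicts the minimality of [alpha(X)]. *)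
Require Import Defs.
From HB Require Import structures.
From mathcomp Require Import all_boot all_order all_algebra.

Import GRing.Theory.

Lemma exists_form_vanishing {K : fieldType} {k b m : nat}
    (v : 'I_m -> 'I_k.+1 -> K) :
  m < 'C(b + k, k) ->
  exists g : {mpoly K[k.+1]},
    [/\ g != 0%R, g \is b.-homog & forall i, g.@[v i] = 0%R].
Proof.
move=> lt_m; pose V := dhomog k.+1 K b.
pose ev (g : V) : 'rV[K]_m := (\row_i (g : {mpoly K[k.+1]}).@[v i])%R.
have ev_lin : linear ev.
  by move=> c p q; apply/rowP=> i; rewrite !mxE -mevalZ -mevalD -linearP.
pose evL := GRing.isLinear.Build K V 'rV[K]_m _ ev ev_lin.
pose F : {linear V -> 'rV[K]_m} := HB.pack ev evL.
(* Rank-nullity: with zero kernel the image in ['rV_m] would have the dimension of [V], which is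
   ['C(b + k, b)], equal by symmetry to ['C(b + k, k)] and so larger than [m]. *)
have ker_neq0 : lker (linfun F) != 0%VS.
  apply/negP=> /eqP ker0.
  have := limg_ker_dim (linfun F) fullv.
  rewrite ker0 capv0 dimv0 add0n => dimE.
  have := dimvS (subvf (linfun F @: fullv)).
  rewrite dimE !dimvf /dim /= mul1n => le_m.
  by move: lt_m; rewrite -(bin_sub (leq_addl b k)) addnK ltnNge le_m.
exists (vpick (lker (linfun F)) : V); split.
- by apply: contra ker_neq0 => g0; rewrite -vpick0.
- exact: dhomog_is_dhomog.
- move=> i; have := memv_pick (lker (linfun F)).
  by rewrite memv_ker lfunE /= => /eqP /rowP /(_ i); rewrite !mxE.
Qed.

Lemma vanishing_form_in_ideal {K : fieldType} {k : nat}
    {X : seq (ppoint K k)} {f : {mpoly K[k]}} :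
  vanishing_form X f -> defining_ideal X f.
Proof.
move=> Xf; exists [:: (1%R, f)]; split; last by rewrite big_seq1 mul1r.
by move=> p; rewrite inE => /eqP ->.
Qed.

Lemma initial_degree_le_form {K : fieldType} {k : nat}
    {X : seq (ppoint K k)} {d : nat} {g : {mpoly K[k]}} :
  g \is d.-homog -> g != 0%R -> (forall P, P \in X -> peval g P = 0%R) ->
  initial_degree X <= d.
Proof.
move=> g_hom g_neq0 Xg.
have h : exists f, [/\ defining_ideal X f, f != 0%R & d = (msize f).-1].
  exists g; split=> //.
    by apply: vanishing_form_in_ideal; split=> //; exists d.
  (* The leading monomial of [g] lies in its support, so homogeneity makes its degree [d]. *)
  by rewrite -(mlead_deg g_neq0); exact/esym/(dhomog_mf g_hom)/mlead_supp.
by apply: (proj2 (leastP _)) => //; exists d.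
Qed.

(** A power of the variable whose coordinate is 1 in the normalized representative. This makes the
    code nonzero, so that its minimum distance is a genuine minimum. *)
Lemma nonvanishing_form {K : fieldType} {k : nat} (P : ppoint K k) (d : nat) :
  exists2 f : {mpoly K[k]}, f \is d.-homog & peval f P = 1%R.
Proof.
have /existsP[i /andP[/eqP Pi1 _]] := valP P.
exists ('X_i ^+ d)%R; last by rewrite /peval rmorphXn /= mevalXU Pi1 expr1n.
by have := dhomogMn d (_ : ('X_i : {mpoly K[k]}) \is 1.-homog);
  rewrite mul1n; apply; rewrite dhomogX; apply/eqP; exact: mdeg1.
Qed.

(** Below the initial degree no nonzero form vanishes on [X], so [f != 0] stands for [f] lying
    outside the ideal. *)
Lemma nonvanishing_count_ge (K : fieldType) (k n : nat)
    (X : n.-tuple (ppoint K k.+1)) (d : nat) (f : {mpoly K[k.+1]}) :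
  d < initial_degree X -> f \is d.-homog -> f != 0%R ->
  'C((initial_degree X - 1 - d) + k, k)
    <= #|[set i | peval f (tnth X i) != 0%R]|.
Proof.
set Y := [set _ | _] => lt_d f_hom f_neq0; rewrite leqNgt; apply/negP.
move=> /(exists_form_vanishing (fun j i => tnth X (enum_val j) 0%R i)).
move=> [g [g_neq0 g_hom Yg]].
have fg_neq0 : (f * g)%R != 0%R by rewrite mulf_neq0.
have Xfg P : P \in (X : seq _) -> peval (f * g)%R P = 0%R.
  move=> /tnthP[i ->]; rewrite /peval mevalM.
  have [Yi|] := boolP (i \in Y).
    by have := Yg (enum_rank_in Yi i); rewrite enum_rankK_in // => ->;
      rewrite mulr0.
  by rewrite inE negbK => /eqP fi; rewrite /peval in fi; rewrite fi mul0r.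
have := initial_degree_le_form (dhomogM f_hom g_hom) fg_neq0 Xfg.
(* The product has degree [d + (alpha - 1 - d) = alpha - 1]. The truncated subtractions are exact
   because [d < alpha], which also gives [alpha > 0]. *)
by rewrite -subnDA add1n addnBA // subnS addKn leqNgt prednK ?leqnn //;
  apply: leq_ltn_trans lt_d.
Qed.

Theorem theorem3p5 (K : fieldType) (k n : nat) (X : n.-tuple (ppoint K k)) (a : nat)
    (hk : 3 <= k) (X_distinct : uniq X) (X_nondeg : ~ in_hyperplane X)
    (ha : 1 <= a <= initial_degree X - 1) :
  'C((initial_degree X - 1 - a) + (k - 1), k - 1)
    <= minimum_distance (evaluation_code X a).
Proof.
case: k hk X X_distinct X_nondeg ha => // k _ X _ X_nondeg /andP[a_gt0 le_a].
(* Since [a >= 1], the bound forces [alpha - 1 >= 1], so the subtraction is not truncated. *)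
have lt_a : a < initial_degree X.
  by move: a_gt0 le_a; case: initial_degree => [|d];
    rewrite ?subSS ?subn0 ?ltnS //; case: a.
(* The empty set lies on every hyperplane, for instance the one with all coefficients 1. *)
have /hasP[P /tnthP[i0 _] _] : has predT X.
  rewrite has_predT lt0n; apply/negP=> /nilP X0; apply: X_nondeg.
  by exists (const_mx 1%R); rewrite ?X0 //; apply/eqP=> /rowP /(_ ord0) /eqP;
    rewrite !mxE oner_eq0.
have [f f_hom fP] := nonvanishing_form (tnth X i0) a.
(* For [least] to be attained, two distinct codewords are needed: the word of [f] and 0. *)
have [|[u [v [[fu fu_hom uE] [fv fv_hom vE] uv dE]]] _] :=
  @leastP (fun d => exists u v, [/\ evaluation_code X a u,
    evaluation_code X a v, u != v & d = hamming_distance u v]).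
  set u : 'rV[K]_n := (\row_i peval f (tnth X i))%R.
  exists (hamming_distance u 0%R), u, 0%R; split=> //; first by exists f.
    by exists 0%R; rewrite ?dhomog0 //; apply/rowP=> i; rewrite !mxE /peval meval0.
  by apply/eqP=> /rowP /(_ i0) /eqP; rewrite !mxE fP oner_eq0.
rewrite /minimum_distance dE.
(* By linearity, the distance of two codewords is the weight of the word of [fu - fv]. *)
have -> : hamming_distance u v = #|[set i | peval (fu - fv)%R (tnth X i) != 0%R]|.
  by apply: eq_card => i; rewrite !inE uE vE !mxE /peval mevalB subr_eq0.
rewrite subSS subn0; apply: nonvanishing_count_ge => //; first exact: rpredB.
by apply: contra uv => /eqP; rewrite uE vE => /eqP; rewrite subr_eq0 => /eqP ->.
Qed.
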